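(* Let $f\equiv1$ on $\Omega$, and write $X_1$, $J_1$ for the corresponding $X_f$, $J_f$. Then $X_1=X_2$ and $$J_1(s,t)=K_\infty(s,t)\qquad(s,t\in X_2).$$ In particular, $J_1$ is $L$-invariant on $X_2$, i.e. $(LJ_1)(s,t)=J_1(s,t)$ for all $s,t\in X_2$.
   Context: Let $X$ be a set, $m\ge1$ an integer, and $\varphi_1,\dots,\varphi_m:X\to X$ maps. A kernel $J:Y\times Y\to\mathbb{C}$ is positive definite if $\sum_{\alpha,\beta}\overline{c_\alpha}c_\beta J(s_\alpha,s_\beta)\ge0$ for all finite families $(c_\alpha,s_\alpha)\in\mathbb{C}\times Y$; $J_1\le J_2$ means that $J_2-J_1$ is positive definite. The pullback operator is $(LJ)(s,t):=\sum_{i=1}^m J(\varphi_i(s),\varphi_i(t))$. Fix a positive definite kernel $K$ on $X$ with $LK\ge K$. Set $K_0:=K$, $K_{n+1}:=LK_n$, $u_n(s):=K_n(s,s)$ (nondecreasing in $n$), $u_\infty(s):=\lim_nu_n(s)\in[0,\infty]$, $X_{\mathrm{fin}}:=\{s\in X:u_\infty(s)<\infty\}$. Each $\varphi_i$ maps $X_{\mathrm{fin}}$ into itself. For $s,t\in X_{\mathrm{fin}}$ the limit $K_\infty(s,t):=\lim_nK_n(s,t)$ exists; $K_\infty$ is positive definite on $X_{\mathrm{fin}}$ and $LK_\infty=K_\infty$ there; $K_\infty(s,s)=u_\infty(s)$. Words: $W_n:=\{1,\dots,m\}^n$, $W_0=\{\emptyset\}$; for $w=i_1\cdots i_n\in W_n$,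 $\varphi_w:=\varphi_{i_n}\circ\cdots\circ\varphi_{i_1}$ ($\varphi_\emptyset=\mathrm{id}$). $\Omega:=\{1,\dots,m\}^{\mathbb{N}}$ with product $\sigma$-algebra and product probability measure $\mu$ making the coordinates independent and uniform on $\{1,\dots,m\}$. For $\omega=\omega_1\omega_2\cdots\in\Omega$, $\omega|n:=\omega_1\cdots\omega_n\in W_n$ ($\omega|0=\emptyset$). For $s,t\in X_{\mathrm{fin}}$, $M_n(s,t;\omega):=m^nK_\infty(\varphi_{\omega|n}(s),\varphi_{\omega|n}(t))$. For $s\in X_{\mathrm{fin}}$ let $B(s):=\sup_{n\ge0}\{m^n\sum_{w\in W_n}u_\infty(\varphi_w(s))^2\}\in[0,\infty]$, and $X_2:=\{s\in X_{\mathrm{fin}}:B(s)<\infty\}$ (so $X_2$ is this set, not an $X_f$ with $f\equiv2$); each $\varphi_k$ maps $X_2$ into itself. For $s,t\in X_2$, $M_n(s,t;\cdot)$ converges in $L^2(\Omega,\mu)$ and $\mu$-almost surely; $M_\infty(s,t;\cdot)\in L^2(\Omega,\mu)$ denotes (a fixed measurable version of) the limit, with $M_\infty(s,s;\cdot)\ge0$; $h(s;\omega):=M_\infty(s,s;\omega)\in[0,\infty)$. For measurable $f:\Omega\to[0,\infty]$ let $X_f:=\{s\in X_2:\int_\Omega f(\omega)h(s;\omega)\,d\mu(\omega)<\infty\}$ and, for $s,t\in X_f$, $J_f(s,t):=\int_\Omega f(\omega)M_\infty(s,t;\omega)\,d\mu(\omega)$ (absolutely convergent). *)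

(* Defs.v *)
From HB Require Import structures.
From mathcomp Require Import all_boot all_order all_algebra.
From mathcomp Require Import all_classical all_reals all_analysis.
From mathcomp Require Import complex.

Set Implicit Arguments.
Unset Strict Implicit.
Unset Printing Implicit Defensive.

Import Order.TTheory GRing.Theory Num.Theory.
Import numFieldNormedType.Exports.
Import ComplexField.Normc.

Local Open Scope classical_set_scope.
Local Open Scope ring_scope.

(* Throughout, the family of m >= 1 maps is indexed by 'I_p.+1, with
   m = p.+1.  The complex numbers are R[i]; limits are taken in the regular
   module R[i]^o, which carries the topology of the norm `|z|.  The order
   0 <= z on R[i] means that z is real and nonnegative. *)

Section Kernels.
Context {R : realType} {X : Type}.

Definition posdef (J : X -> X -> R[i]) : Prop :=
  forall (n : nat) (c : 'I_n -> R[i]) (s : 'I_n -> X),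
    0 <= \sum_(a < n) \sum_(b < n) (c a)^* * c b * J (s a) (s b).

Definition kernel_le (J1 J2 : X -> X -> R[i]) : Prop :=
  posdef (fun s t => J2 s t - J1 s t).

Context {p : nat}.
Variable phi : 'I_p.+1 -> X -> X.

Definition pullback (J : X -> X -> R[i]) : X -> X -> R[i] :=
  fun s t => \sum_(i < p.+1) J (phi i s) (phi i t).

(* phi_{i_1 ... i_n} = phi_{i_n} \o ... \o phi_{i_1}: the first letter acts
   first. *)
Definition phi_word (w : seq 'I_p.+1) (s : X) : X :=
  foldl (fun x i => phi i x) s w.

Variable K : X -> X -> R[i].

Definition kernel_iter (n : nat) : X -> X -> R[i] := iter n pullback K.

(* K_n(s, s) is a nonnegative real when K is positive definite. *)
Definition u_seq (n : nat) (s : X) : R := complex.Re (kernel_iter n s s).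

Definition u_inf (s : X) : \bar R := limn (fun n => (u_seq n s)%:E).

Definition X_fin : set X := [set s | (u_inf s < +oo)%E].

(* Meaningful only for s, t in X_fin; an arbitrary value elsewhere. *)
Definition K_inf (s t : X) : R[i] :=
  limn (fun n => kernel_iter n s t : R[i]^o).

Definition B_sup (s : X) : \bar R :=
  ereal_sup (range (fun n : nat =>
    ((p.+1 ^ n)%:R%:E *
       \sum_(w : n.-tuple 'I_p.+1) u_inf (phi_word w s) ^+ 2)%E)).

Definition X_two : set X := [set s | X_fin s /\ (B_sup s < +oo)%E].

End Kernels.

HB.instance Definition _ (p : nat) := isPointed.Build 'I_p.+1 ord0.

Definition coordinate_sets (p : nat) : set (set (nat -> 'I_p.+1)) :=
  [set A | exists (k : nat) (S : {set 'I_p.+1}), A = [set w | w k \in S]].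
Arguments coordinate_sets : clear implicits.

(* {1, ..., m}^N with the product sigma-algebra. *)
Notation Omega p := (g_sigma_algebraType (coordinate_sets p)).

(* mu is the product of the uniform probability measures on the coordinates:
   this determines mu on the pi-system of measurable rectangles, hence
   everywhere. *)
Definition uniform_product {R : realType} (p : nat)
    (mu : probability (Omega p) R) : Prop :=
  forall (n : nat) (S : 'I_n -> {set 'I_p.+1}),
    mu [set w : Omega p | forall k : 'I_n, w k \in S k] =
    (\prod_(k < n) (#|S k|%:R / p.+1%:R))%:E.

Section LimitDensity.
Context {R : realType} {X : Type} {p : nat}.
Variable phi : 'I_p.+1 -> X -> X.
Variable K : X -> X -> R[i].
Variable mu : probability (Omega p) R.

Definition M_seq (n : nat) (s t : X) (w : Omega p) : R[i] :=
  (p.+1 ^ n)%:R *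
  K_inf phi K (phi_word phi (mkseq w n) s) (phi_word phi (mkseq w n) t).

Definition cmeasurable (g : Omega p -> R[i]) : Prop :=
  measurable_fun [set: Omega p] (fun w => complex.Re (g w)) /\
  measurable_fun [set: Omega p] (fun w => complex.Im (g w)).

Definition cnorm2 (g : Omega p -> R[i]) : \bar R :=
  Lnorm mu 2%:E (fun w => (normc (g w))%:E).

Record limit_version (Minf : X -> X -> Omega p -> R[i]) : Prop := {
  limit_version_measurable : forall s t, X_two phi K s -> X_two phi K t ->
    cmeasurable (Minf s t);
  limit_version_L2 : forall s t, X_two phi K s -> X_two phi K t ->
    (cnorm2 (Minf s t) < +oo)%E;
  limit_version_cvg_L2 : forall s t, X_two phi K s -> X_two phi K t ->
    cnorm2 (fun w => M_seq n s t w - Minf s t w) @[n --> \oo] --> 0%E;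
  limit_version_cvg_ae : forall s t, X_two phi K s -> X_two phi K t ->
    {ae mu, forall w, (M_seq n s t w : R[i]^o) @[n --> \oo] --> (Minf s t w : R[i]^o)};
  limit_version_diag : forall s, X_two phi K s ->
    forall w, 0 <= Minf s s w
}.

Variable Minf : X -> X -> Omega p -> R[i].

Definition h_diag (s : X) (w : Omega p) : R := complex.Re (Minf s s w).

Definition X_weight (f : Omega p -> \bar R) : set X :=
  [set s | X_two phi K s /\
           (\int[mu]_w (f w * (h_diag s w)%:E) < +oo)%E].

(* The complex integral of f * Minf s t, through real and imaginary parts;
   it is absolutely convergent for s, t in X_weight f. *)
Definition J_weight (f : Omega p -> \bar R) (s t : X) : R[i] :=
  Complex
    (fine (\int[mu]_w (f w * (complex.Re (Minf s t w))%:E))%E)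
    (fine (\int[mu]_w (f w * (complex.Im (Minf s t w))%:E))%E).

End LimitDensity.

(* Main.v *)
Require Import Defs.
From mathcomp Require Import all_boot all_order all_algebra.
From mathcomp Require Import all_classical all_reals all_analysis.
From mathcomp Require Import measurable_realfun complex ring lra.

Set Implicit Arguments.
Unset Strict Implicit.
Unset Printing Implicit Defensive.

Import Order.TTheory GRing.Theory Num.Theory.
Import numFieldNormedType.Exports.
Import ComplexField.Normc.

Local Open Scope classical_set_scope.
Local Open Scope ring_scope.

(** The weight [1] turns [J_1(s, t)] into the expectation of [M_oo(s, t)], and
    this expectation is [K_oo(s, t)] because [M_n(s, t)] is a martingale of
    constant mean.

    Every [M_n(s, t; w)] depends only on the first [n] letters of [w], and each
    of the [m^n] words of length [n] has probability [m^-n].  The weight [m^n]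
    in [M_n] cancels this probability, so the mean of [M_n] is the sum of
    [K_oo(phi_w s, phi_w t)] over all words of length [n], that is
    [(L^n K_oo)(s, t)], which is [K_oo(s, t)] by invariance
    ([M_seq_integral]).  On a probability space the [L^1] norm is at most the
    [L^2] norm, so convergence in [L^2] preserves this constant mean in the
    limit ([integral_L2_limit], [Minf_integral]).  Finiteness of the integral of
    [M_oo(s, s)] gives [X_1 = X_2], and the invariance of [J_1] is that of
    [K_oo], once [phi_i] is known to preserve [X_2] ([X_two_phi]).

    The existence and invariance of [K_oo] on [X_fin] rest on polarization:
    the real and imaginary parts of a positive definite kernel off the diagonal
    are bounded by its diagonal ([posdef_parts]).  Applied to the positive
    definite differences [K_(n+1) - K_n], this makes the off-diagonal entries
    converge as soon as the bounded monotone diagonals do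
    ([kernel_iter_cvg]). *)

(** * Real and imaginary parts *)

Section ComplexParts.
Context (R : realType).

Lemma ReB (x y : R[i]) : complex.Re (x - y) = complex.Re x - complex.Re y.
Proof. by case: x y => [? ?] [? ?]. Qed.

Lemma ImB (x y : R[i]) : complex.Im (x - y) = complex.Im x - complex.Im y.
Proof. by case: x y => [? ?] [? ?]. Qed.

Lemma Re_sum (I : finType) (F : I -> R[i]) :
  complex.Re (\sum_i F i) = \sum_i complex.Re (F i).
Proof. by apply: (big_morph (@complex.Re R)) => // -[? ?] [? ?]. Qed.

Lemma Im_sum (I : finType) (F : I -> R[i]) :
  complex.Im (\sum_i F i) = \sum_i complex.Im (F i).
Proof. by apply: (big_morph (@complex.Im R)) => // -[? ?] [? ?]. Qed.

Lemma natr_complex n : n%:R = Complex n%:R 0 :> R[i].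
Proof. by rewrite -(rmorph_nat (real_complex R)). Qed.

Lemma Re_natrM n (z : R[i]) : complex.Re (n%:R * z) = n%:R * complex.Re z.
Proof. by rewrite natr_complex; case: z => x y /=; rewrite mul0r subr0. Qed.

Lemma Im_natrM n (z : R[i]) : complex.Im (n%:R * z) = n%:R * complex.Im z.
Proof. by rewrite natr_complex; case: z => x y /=; rewrite mul0r addr0. Qed.

Lemma normc_ge_parts (z : R[i]) :
  `|complex.Re z| <= normc z /\ `|complex.Im z| <= normc z.
Proof.
by case: z => x y /=; rewrite -!sqrtr_sqr !ler_wsqrtr ?lerDl ?lerDr ?sqr_ge0.
Qed.

Lemma complex_parts_cvg (z : nat -> R[i]) (a b : R) :
  complex.Re (z n) @[n --> \oo] --> a ->
  complex.Im (z n) @[n --> \oo] --> b ->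
  (z n : R[i]^o) @[n --> \oo] --> (Complex a b : R[i]^o).
Proof.
move=> za zb; apply/cvgrPdist_lt => -[e e'].
rewrite ltcE /= => /andP[/eqP -> e0].
have e20 : 0 < e / 2 by rewrite divr_gt0.
near=> n.
have ha : `|a - complex.Re (z n)| < e / 2.
  by near: n; move/cvgrPdist_lt : za; apply.
have hb : `|b - complex.Im (z n)| < e / 2.
  by near: n; move/cvgrPdist_lt : zb; apply.
rewrite [Complex a b - z n]complexE.
apply: (le_lt_trans (ler_normD _ _)).
rewrite normrM.
have -> : `|'i%C : R[i]| = 1 by rewrite normc_def /= expr0n expr1n add0r sqrtr1.
rewrite mul1r.
case: (z n) ha hb => x y /= ha hb.
rewrite !normc_def /= expr0n /= !addr0 !sqrtr_sqr -rmorphD /=.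
by rewrite ltcR [e]splitr ltrD.
Unshelve. all: end_near. Qed.

End ComplexParts.

(** * Positive definite kernels and their pullbacks *)

(** The increments of [a] are controlled by those of [v], so [2 a + v] is again
    nondecreasing and bounded, and [a] is half the difference of two convergent
    sequences.  The factor 2 is the one that polarization produces. *)
Lemma dominated_increments_cvg (R : realType) (a v : R^nat) :
  (forall n, `|(a n.+1 - a n) *+ 2| <= v n.+1 - v n) ->
  has_ubound (range v) -> (forall n, `|a n *+ 2| <= v n) -> cvgn a.
Proof.
move=> av [M vM] av'.
have vM' n : v n <= M by apply: vM; exists n.
have cv : cvgn v.
  apply: nondecreasing_is_cvgn; last by exists M.
  apply/nondecreasing_seqP => n; rewrite -subr_ge0.
  exact: le_trans (av n).
have cav : cvgn (fun n => a n *+ 2 + v n).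
  apply: nondecreasing_is_cvgn.
    apply/nondecreasing_seqP => n; have := av n.
    by rewrite ler_norml => /andP[]; lra.
  exists (M + M) => _ [n _ <-]; have := av' n; have := vM' n.
  by rewrite ler_norml => ? /andP[]; lra.
have -> : a = (fun n => 2^-1 * ((a n *+ 2 + v n) - v n)).
  by apply/funext => n; field.
by apply: is_cvgMr; apply: is_cvgB.
Qed.

Section Kernels.
Context (R : realType) (X : Type).
Implicit Types J : X -> X -> R[i].

Lemma posdef_diag J : posdef J -> forall s, 0 <= J s s.
Proof.
move=> /(_ 1%N (fun=> 1)) H s; have := H (fun=> s).
by rewrite !big_ord_recl !big_ord0 !addr0 rmorph1 !mul1r.
Qed.

Lemma posdef_pair J : posdef J -> forall s t (c : R[i]),
  0 <= J s s + c * J s t + (c^* * J t s + c^* * c * J t t).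
Proof.
move=> H s t c.
have := H 2%N (fun i => if i == ord0 then 1 else c)
             (fun i => if i == ord0 then s else t).
by rewrite !big_ord_recl !big_ord0 /= !addr0 rmorph1 !mul1r mulr1.
Qed.

(** Polarization: the pairs of coefficients [(1, c)] with [c] one of
    [1], [-1], ['i], [-'i] give four sign conditions, whose imaginary parts say
    that [J] is hermitian at [(s, t)] and whose real parts are the two
    bounds. *)
Lemma posdef_parts J : posdef J -> forall s t,
  `|complex.Re (J s t) *+ 2| <= complex.Re (J s s) + complex.Re (J t t) /\
  `|complex.Im (J s t) *+ 2| <= complex.Re (J s s) + complex.Re (J t t).
Proof.
move=> pJ s t.
have := posdef_diag pJ s; have := posdef_diag pJ t.
have := posdef_pair pJ s t 1; have := posdef_pair pJ s t (-1).
have := posdef_pair pJ s t (Complex 0 1).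
have := posdef_pair pJ s t (Complex 0 (-1)).
have conjE (x y : R) : (Complex x y)^* = Complex x (- y) :> R[i] by [].
have oneE : 1 = Complex 1 0 :> R[i] by [].
rewrite oneE.
have -> : - Complex 1 0 = Complex (-1) 0 :> R[i].
  by congr Complex; rewrite oppr0.
rewrite !conjE.
case: (J s s) (J t t) (J s t) (J t s) => [a a'] [b b'] [c c'] [d d'].
rewrite !lecE /=.
do 6! (case/andP => /eqP ? ?).
rewrite !ler_norml; split; apply/andP; split; lra.
Qed.

Context (p : nat) (phi : 'I_p.+1 -> X -> X).

Lemma posdef_pullback J : posdef J -> posdef (pullback phi J).
Proof.
move=> pJ n c s; rewrite /pullback.
have -> : \sum_(a < n) \sum_(b < n)
    (c a)^* * c b * (\sum_(i < p.+1) J (phi i (s a)) (phi i (s b))) =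
  \sum_(i < p.+1) \sum_(a < n) \sum_(b < n)
    (c a)^* * c b * J (phi i (s a)) (phi i (s b)).
  rewrite [RHS]exchange_big; apply: eq_bigr => a _.
  by rewrite [RHS]exchange_big; apply: eq_bigr => b _; rewrite mulr_sumr.
by apply: sumr_ge0 => i _; exact: pJ.
Qed.

Context (K : X -> X -> R[i]).
Hypothesis K_posdef : posdef K.
Hypothesis K_le_LK : kernel_le K (pullback phi K).

Local Notation Kn := (kernel_iter phi K).
Local Notation u := (u_seq phi K).
Local Notation uoo := (u_inf phi K).
Local Notation Xfin := (X_fin phi K).

Lemma kernel_iter_posdef n : posdef (Kn n).
Proof. by elim: n => [//|n IH]; exact: posdef_pullback. Qed.

Lemma kernel_iter_step n : kernel_le (Kn n) (Kn n.+1).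
Proof.
elim: n => [//|n /posdef_pullback IH]; rewrite /kernel_le.
have -> // : (fun s t => Kn n.+2 s t - Kn n.+1 s t) =
  pullback phi (fun s t => Kn n.+1 s t - Kn n s t).
by apply/funext => s; apply/funext => t; rewrite /pullback sumrB.
Qed.

Lemma u_seq_ge0 n s : 0 <= u n s.
Proof.
by have := posdef_diag (kernel_iter_posdef n) s; rewrite lecE => /andP[].
Qed.

Lemma u_seq_nd s : nondecreasing_seq (u ^~ s).
Proof.
apply/nondecreasing_seqP => n.
have := posdef_diag (kernel_iter_step n) s.
by rewrite lecE ReB => /andP[_]; rewrite subr_ge0.
Qed.

Lemma u_seq_phi n i s : u n (phi i s) <= u n.+1 s.
Proof.
rewrite [leRHS]Re_sum (bigD1 i) //= lerDl.
by apply: sumr_ge0 => j _; exact: u_seq_ge0.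
Qed.

Lemma u_seq_cvg s :
  (u n s)%:E @[n --> \oo] --> ereal_sup (range (fun n => (u n s)%:E)).
Proof.
apply: ereal_nondecreasing_cvgn => m n mn.
by rewrite lee_fin; exact: u_seq_nd.
Qed.

Lemma u_infE s : uoo s = ereal_sup (range (fun n => (u n s)%:E)).
Proof. exact/cvg_lim/u_seq_cvg. Qed.

Lemma u_seq_le_inf n s : ((u n s)%:E <= uoo s)%E.
Proof. by rewrite u_infE; apply: ereal_sup_ubound; exists n. Qed.

Lemma u_inf_ge0 s : (0 <= uoo s)%E.
Proof. by apply: le_trans (u_seq_le_inf 0 s); rewrite lee_fin u_seq_ge0. Qed.

Lemma u_inf_phi i s : (uoo (phi i s) <= uoo s)%E.
Proof.
rewrite [leLHS]u_infE; apply: ge_ereal_sup => _ [n _ <-].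
by apply: le_trans (u_seq_le_inf n.+1 s); rewrite lee_fin u_seq_phi.
Qed.

Lemma X_fin_phi i s : Xfin s -> Xfin (phi i s).
Proof. exact/le_lt_trans/u_inf_phi. Qed.

Lemma u_seq_bound s : Xfin s -> exists M, forall n, u n s <= M.
Proof.
move=> sfin; have ufin : uoo s \is a fin_num.
  by rewrite ge0_fin_numE // u_inf_ge0.
exists (fine (uoo s)) => n; rewrite -lee_fin fineK //; exact: u_seq_le_inf.
Qed.

(** The diagonal [u n s + u n t] is monotone and bounded on [X_fin], and by
    polarization it controls both parts of [K_n(s, t)] and of its increments,
    since the differences [K_(n+1) - K_n] are positive definite. *)
Lemma kernel_iter_cvg s t : Xfin s -> Xfin t ->
  (Kn n s t : R[i]^o) @[n --> \oo] --> (K_inf phi K s t : R[i]^o).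
Proof.
move=> /u_seq_bound[M sM] /u_seq_bound[N tN].
have bnd : has_ubound (range (fun n => u n s + u n t)).
  by exists (M + N) => _ [n _ <-]; exact: lerD.
have cRe : cvgn (fun n => complex.Re (Kn n s t)).
  apply: (dominated_increments_cvg _ bnd) => n; last first.
    exact: (posdef_parts (kernel_iter_posdef n) s t).1.
  have := (posdef_parts (kernel_iter_step n) s t).1; rewrite !ReB.
  by move=> /le_trans; apply; rewrite /u_seq; lra.
have cIm : cvgn (fun n => complex.Im (Kn n s t)).
  apply: (dominated_increments_cvg _ bnd) => n; last first.
    exact: (posdef_parts (kernel_iter_posdef n) s t).2.
  have := (posdef_parts (kernel_iter_step n) s t).2; rewrite !ReB ImB.
  by move=> /le_trans; apply; rewrite /u_seq; lra.
have := complex_parts_cvg cRe cIm => cK.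
by rewrite /K_inf (cvg_lim _ cK) //; exact: norm_hausdorff.
Qed.

Lemma K_inf_invariant s t : Xfin s -> Xfin t ->
  pullback phi (K_inf phi K) s t = K_inf phi K s t.
Proof.
move=> sfin tfin.
have h1 : (Kn n.+1 s t : R[i]^o) @[n --> \oo] --> (K_inf phi K s t : R[i]^o).
  by rewrite (cvg_shiftS (fun n => Kn n s t : R[i]^o)); exact: kernel_iter_cvg.
have h2 : (Kn n.+1 s t : R[i]^o) @[n --> \oo] -->
    (pullback phi (K_inf phi K) s t : R[i]^o).
  have := @cvg_big R[i]^o 'I_p.+1 +%R 0 predT (@add_continuous R[i]^o) nat \oo
    (index_enum _) (fun i n => Kn n (phi i s) (phi i t))
    (fun i => K_inf phi K (phi i s) (phi i t)) _.
  apply => i _.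
  by apply: kernel_iter_cvg; exact: X_fin_phi.
exact: (cvg_unique _ h2 h1).
Qed.

(** * Sums over words *)

Lemma sum_words_cons (V : nmodType) n (F : seq 'I_p.+1 -> V) :
  \sum_(w : n.+1.-tuple 'I_p.+1) F w =
  \sum_(i < p.+1) \sum_(w : n.-tuple 'I_p.+1) F (i :: w).
Proof.
rewrite pair_big /= (reindex (fun iw : 'I_p.+1 * n.-tuple 'I_p.+1 =>
  [tuple of iw.1 :: iw.2])) //.
exists (fun w : n.+1.-tuple 'I_p.+1 => (thead w, [tuple of behead w])).
  by move=> [i w] _; congr pair; apply: val_inj.
by move=> w _; rewrite [RHS]tuple_eta; apply: val_inj.
Qed.

(** The iterated invariance [L^n K_oo = K_oo], written out over words. *)
Lemma K_inf_words n s t : Xfin s -> Xfin t ->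
  \sum_(w : n.-tuple 'I_p.+1)
    K_inf phi K (phi_word phi w s) (phi_word phi w t) = K_inf phi K s t.
Proof.
elim: n s t => [|n IH] s t sfin tfin.
  rewrite (bigD1 [tuple]) //= big1 ?addr0 // => w /negP[]; apply/eqP.
  by rewrite tuple0.
rewrite (sum_words_cons _
  (fun w => K_inf phi K (phi_word phi w s) (phi_word phi w t))).
rewrite -[RHS]K_inf_invariant //; apply: eq_bigr => i _.
by rewrite -IH //; exact: X_fin_phi.
Qed.

(** Prefixing words by the letter [i] sends the words of length [n] from
    [phi i s] into the words of length [n.+1] from [s], so that each term of the
    supremum at [phi i s] is bounded by the next term at [s]. *)
Lemma X_two_phi i s : X_two phi K s -> X_two phi K (phi i s).
Proof.
move=> [sfin Bs]; split; first exact: X_fin_phi.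
apply: le_lt_trans Bs; apply: ge_ereal_sup => _ [n _ <-].
apply: (@le_trans _ _ ((p.+1 ^ n.+1)%:R%:E *
    \sum_(w : n.+1.-tuple 'I_p.+1) uoo (phi_word phi w s) ^+ 2)%E); last first.
  by apply: ereal_sup_ubound; exists n.+1.
have sqr_ge0 (x : X) : (0 <= uoo x ^+ 2)%E by rewrite expe_ge0 // u_inf_ge0.
apply: lee_pmul => //.
- exact: sume_ge0.
- by rewrite lee_fin ler_nat leq_pexp2l.
rewrite (sum_words_cons _ (fun w => uoo (phi_word phi w s) ^+ 2)%E).
rewrite [leRHS](bigD1 i) //=; apply: leeDl.
by apply: sume_ge0 => j _; apply: sume_ge0 => w _; exact: sqr_ge0.
Qed.

End Kernels.

(** * Functions of finitely many letters *)

Section Cylinders.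
Context (R : realType) (p : nat) (mu : probability (Omega p) R).
Hypothesis mu_product : uniform_product mu.

Definition cylinder n (v : n.-tuple 'I_p.+1) : set (Omega p) :=
  [set w | mkseq w n = v].

Lemma cylinderE n (v : n.-tuple 'I_p.+1) :
  cylinder v = [set w : Omega p | forall k : 'I_n, w k \in [set tnth v k]%SET].
Proof.
apply/seteqP; split => w /=.
  by move=> wv k; rewrite inE (tnth_nth (w k)) -wv nth_mkseq.
move=> wv; apply: (@eq_from_nth _ ord0) => [|k];
  rewrite size_mkseq ?size_tuple // => kn.
rewrite nth_mkseq //; have := wv (Ordinal kn).
by rewrite inE (tnth_nth ord0) => /eqP.
Qed.

Lemma measurable_cylinder n (v : n.-tuple 'I_p.+1) : measurable (cylinder v).
Proof.
rewrite cylinderE.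
have -> : [set w : Omega p | forall k : 'I_n, w k \in [set tnth v k]%SET] =
    \bigcap_(k in [set: 'I_n]) [set w : Omega p | w k \in [set tnth v k]%SET].
  by apply/seteqP; split => [w wv k _|w wv k]; exact: wv.
apply: fin_bigcap_measurable => // k _.
by apply: sub_sigma_algebra; exists k, [set tnth v k]%SET.
Qed.

(** The cylinder prescribes a single value out of [m] for each of [n]
    independent uniform letters. *)
Lemma cylinder_measure n (v : n.-tuple 'I_p.+1) :
  mu (cylinder v) = ((p.+1 ^ n)%:R^-1)%:E.
Proof.
rewrite cylinderE mu_product; congr EFin.
under eq_bigr do rewrite cards1 mul1r.
by rewrite prodr_const card_ord natrX exprVn.
Qed.

(** A function of the first [n] letters is constant on each cylinder of length
    [n], hence a simple function. *)
Lemma prefix_functionE (F : seq 'I_p.+1 -> R) n :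
  (fun w : Omega p => (F (mkseq w n))%:E) =
  (fun w => \sum_(v : n.-tuple 'I_p.+1) (F v)%:E * (\1_(cylinder v) w)%:E)%E.
Proof.
apply/funext => w; have sz : size (mkseq w n) == n by rewrite size_mkseq.
rewrite (bigD1 (Tuple sz)) //= indicE mem_set // mule1 big1 ?adde0 // => v vw.
rewrite indicE memNset ?mule0 // => wv; move/eqP: vw; apply.
exact: val_inj.
Qed.

Lemma prefix_function_integrable (F : seq 'I_p.+1 -> R) n :
  mu.-integrable setT (fun w : Omega p => (F (mkseq w n))%:E).
Proof.
rewrite prefix_functionE; apply: integrable_sum => // v _.
apply: integrableZl => //; apply: integrable_indic.
exact: measurable_cylinder.
Qed.

Lemma prefix_function_integral (F : seq 'I_p.+1 -> R) n :
  (\int[mu]_w (F (mkseq w n))%:E)%E =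
  (\sum_(v : n.-tuple 'I_p.+1) F v / (p.+1 ^ n)%:R)%:E.
Proof.
have intc (v : n.-tuple 'I_p.+1) :
    mu.-integrable setT (fun w : Omega p => (\1_(cylinder v) w)%:E).
  by apply: integrable_indic; exact: measurable_cylinder.
rewrite prefix_functionE integral_sum //; last by move=> v; exact: integrableZl.
rewrite -sumEFin; apply: eq_bigr => v _.
rewrite integralZl // integral_indic //; last exact: measurable_cylinder.
by rewrite EFinM setIT -(cylinder_measure v).
Qed.

End Cylinders.

(** * Passage to the limit in the mean *)

(** The functions [N n] are a majorant of [|gn n - g|] rather than the
    difference itself so that the real and imaginary parts of a complex sequence
    can both be treated with its modulus.  By Hoelder against the constant 1,
    the integral of [|gn n - g|] is at most the [L^2] norm of [N n]. *)
Lemma integral_L2_limit d (T : measurableType d) (R : realType)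
    (P : probability T R) (g : T -> R) (gn N : nat -> T -> R) (c : R) :
  measurable_fun setT g ->
  (forall n, P.-integrable setT (EFin \o gn n)) ->
  (forall n, (\int[P]_x (gn n x)%:E)%E = c%:E) ->
  (forall n, measurable_fun setT (N n)) ->
  (forall n x, `|gn n x - g x| <= N n x) ->
  (Lnorm P 2%:E (EFin \o N n) @[n --> \oo] --> 0)%E ->
  P.-integrable setT (EFin \o g) /\ (\int[P]_x (g x)%:E)%E = c%:E.
Proof.
move=> mg ign gnc mN gN N0.
have mgn n : measurable_fun setT (gn n).
  by apply/measurable_EFinP; exact: measurable_int (ign n).
have L1_le n : (\int[P]_x `|(gn n x - g x)%:E| <= Lnorm P 2%:E (EFin \o N n))%E.
  have := @hoelder _ _ _ P (N n) (cst 1) 2 2 (mN n) (measurable_cst _).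
  have half : 2^-1 + 2^-1 = 1 :> R by field.
  move=> /(_ (ltr0n _ 2) (ltr0n _ 2) half).
  rewrite Lnorm_cst1 [X in (_ * (X `^ _))%E]probability_setT poweR1r mule1.
  apply: le_trans.
  rewrite Lnorm1; apply: ge0_le_integral => //.
  - apply: measurableT_comp => //; apply/measurable_EFinP.
    exact: measurable_funB.
  - apply: measurableT_comp => //; apply/measurable_EFinP.
    exact: measurable_funM.
  - move=> x _ /=; rewrite mulr1 lee_fin; exact: le_trans (gN n x) (ler_norm _).
(* Integrability of [g] needs only one index at which the difference is
   integrable. *)
have [n0 Nn0] : exists n0, (Lnorm P 2%:E (EFin \o N n0) < 1)%E.
  apply/not_existsP => N1; have : (1 <= 0 :> \bar R)%E.
    by apply: cvge_ge N0; apply: nearW => k; rewrite leNgt; apply/negP/N1.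
  by rewrite lee_fin ler10.
have ig : P.-integrable setT (EFin \o g).
  have -> : EFin \o g = (fun x => (EFin \o gn n0) x - (gn n0 x - g x)%:E)%E.
    by apply/funext => x /=; rewrite -EFinB subKr.
  apply: integrableB => //; apply/integrableP; split.
    by apply/measurable_EFinP; exact: measurable_funB.
  apply: le_lt_trans (L1_le n0) _; exact: lt_trans Nn0 (ltry _).
split => //.
have ifin : (\int[P]_x (g x)%:E)%E \is a fin_num by exact: integrable_fin_num.
have le_n k : (`|c%:E - \int[P]_x (g x)%:E| <= Lnorm P 2%:E (EFin \o N k))%E.
  apply: le_trans (L1_le k); rewrite -(gnc k) -integralB //; last exact: ign.
  apply: le_abse_integral => //.
  by apply: emeasurable_funB; exact/measurable_EFinP.
have : (`|c%:E - \int[P]_x (g x)%:E| <= 0)%E.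
  by apply: cvge_ge N0; apply: nearW.
by rewrite -(fineK ifin) -EFinB abse_EFin lee_fin normr_le0 subr_eq0 => /eqP <-.
Qed.

(** * The density *)

Section LimitDensity.
Context (R : realType) (X : Type) (p : nat).
Context (phi : 'I_p.+1 -> X -> X) (K : X -> X -> R[i]).
Hypothesis K_posdef : posdef K.
Hypothesis K_le_LK : kernel_le K (pullback phi K).
Context (mu : probability (Omega p) R).
Hypothesis mu_product : uniform_product mu.

Lemma M_seq_integrable n s t :
  mu.-integrable setT (fun w => (complex.Re (M_seq phi K n s t w))%:E) /\
  mu.-integrable setT (fun w => (complex.Im (M_seq phi K n s t w))%:E).
Proof.
split.
- exact: (prefix_function_integrable mu (fun v => complex.Re ((p.+1 ^ n)%:R *
    K_inf phi K (phi_word phi v s) (phi_word phi v t)))).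
- exact: (prefix_function_integrable mu (fun v => complex.Im ((p.+1 ^ n)%:R *
    K_inf phi K (phi_word phi v s) (phi_word phi v t)))).
Qed.

(** The probability [m^-n] of a word of length [n] cancels the weight [m^n],
    leaving [(L^n K_oo)(s, t)]. *)
Lemma M_seq_integral n s t : X_fin phi K s -> X_fin phi K t ->
  (\int[mu]_w (complex.Re (M_seq phi K n s t w))%:E)%E =
    (complex.Re (K_inf phi K s t))%:E /\
  (\int[mu]_w (complex.Im (M_seq phi K n s t w))%:E)%E =
    (complex.Im (K_inf phi K s t))%:E.
Proof.
move=> sfin tfin.
rewrite -(K_inf_words K_posdef K_le_LK n sfin tfin) Re_sum Im_sum; split.
- rewrite (prefix_function_integral mu_product (fun v =>
    complex.Re ((p.+1 ^ n)%:R *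
      K_inf phi K (phi_word phi v s) (phi_word phi v t)))).
  congr EFin; apply: eq_bigr => v _.
  by rewrite Re_natrM mulrC mulKf // pnatr_eq0 expn_eq0.
- rewrite (prefix_function_integral mu_product (fun v =>
    complex.Im ((p.+1 ^ n)%:R *
      K_inf phi K (phi_word phi v s) (phi_word phi v t)))).
  congr EFin; apply: eq_bigr => v _.
  by rewrite Im_natrM mulrC mulKf // pnatr_eq0 expn_eq0.
Qed.

Lemma measurable_normc (g : Omega p -> R[i]) : cmeasurable g ->
  measurable_fun setT (fun w => normc (g w)).
Proof.
move=> [mRe mIm].
have -> : (fun w => normc (g w)) =
    (fun w => Num.sqrt (complex.Re (g w) ^+ 2 + complex.Im (g w) ^+ 2)).
  by apply/funext => w; case: (g w).
apply: measurableT_comp.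
  exact: continuous_measurable_fun (@sqrt_continuous R).
by apply: measurable_funD; exact: measurable_funX.
Qed.

Lemma cmeasurableB (f g : Omega p -> R[i]) :
  cmeasurable f -> cmeasurable g -> cmeasurable (fun w => f w - g w).
Proof.
move=> [fRe fIm] [gRe gIm]; split.
- have -> : (fun w => complex.Re (f w - g w)) =
      (fun w => complex.Re (f w) - complex.Re (g w)).
    by apply/funext => w; rewrite ReB.
  exact: measurable_funB.
- have -> : (fun w => complex.Im (f w - g w)) =
      (fun w => complex.Im (f w) - complex.Im (g w)).
    by apply/funext => w; rewrite ImB.
  exact: measurable_funB.
Qed.

Variable Minf : X -> X -> Omega p -> R[i].
Hypothesis Minf_limit : limit_version phi K mu Minf.

(** The means of [M_n(s, t)] all equal [K_oo(s, t)], and convergence in [L^2]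
    carries them over to the limit. *)
Lemma Minf_integral s t : X_two phi K s -> X_two phi K t ->
  (\int[mu]_w (complex.Re (Minf s t w))%:E)%E =
    (complex.Re (K_inf phi K s t))%:E /\
  (\int[mu]_w (complex.Im (Minf s t w))%:E)%E =
    (complex.Im (K_inf phi K s t))%:E.
Proof.
move=> s2 t2; have [mRe mIm] := limit_version_measurable Minf_limit s2 t2.
have N0 := limit_version_cvg_L2 Minf_limit s2 t2.
have mN n : measurable_fun setT
    (fun w => normc (M_seq phi K n s t w - Minf s t w)).
  apply: measurable_normc; apply: cmeasurableB; last by split.
  have [/integrableP[iRe _] /integrableP[iIm _]] := M_seq_integrable n s t.
  by split; apply/measurable_EFinP; [exact: iRe|exact: iIm].
split.
  apply: (integral_L2_limit mRe _ _ mN _ N0).2 => [n|n|n w].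
  - exact: (M_seq_integrable n s t).1.
  - exact: (M_seq_integral n s2.1 t2.1).1.
  - by rewrite -ReB; exact: (normc_ge_parts _).1.
apply: (integral_L2_limit mIm _ _ mN _ N0).2 => [n|n|n w].
- exact: (M_seq_integrable n s t).2.
- exact: (M_seq_integral n s2.1 t2.1).2.
- by rewrite -ImB; exact: (normc_ge_parts _).2.
Qed.

End LimitDensity.

Theorem corollary7p4 (R : realType) (X : Type) (p : nat)
    (phi : 'I_p.+1 -> X -> X) (K : X -> X -> R[i])
    (K_posdef : posdef K) (K_le_LK : kernel_le K (pullback phi K))
    (mu : probability (Omega p) R) (mu_product : uniform_product mu)
    (Minf : X -> X -> Omega p -> R[i])
    (Minf_limit : limit_version phi K mu Minf) :
  let one : Omega p -> \bar R := fun=> 1%E in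
  let X1 := X_weight phi K mu Minf one in
  let J1 := J_weight mu Minf one in
  X1 = X_two phi K /\
  (forall s t, X_two phi K s -> X_two phi K t -> J1 s t = K_inf phi K s t) /\
  (forall s t, X_two phi K s -> X_two phi K t -> pullback phi J1 s t = J1 s t).
Proof.
move=> one X1 J1.
have intM := Minf_integral K_posdef K_le_LK mu_product Minf_limit.
have J1E s t : X_two phi K s -> X_two phi K t -> J1 s t = K_inf phi K s t.
  move=> s2 t2; have [iRe iIm] := intM s t s2 t2.
  rewrite /J1 /J_weight /one; under eq_integral do rewrite mul1e.
  rewrite iRe; under eq_integral do rewrite mul1e.
  by rewrite iIm; case: (K_inf _ _ _ _).
split; [|split] => //.
- apply/seteqP; split => s; first by case.
  move=> s2; split => //; rewrite /one /h_diag.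
  under eq_integral do rewrite mul1e.
  by rewrite (intM s s s2 s2).1 ltry.
- move=> s t s2 t2; rewrite J1E //.
  rewrite -(K_inf_invariant K_posdef K_le_LK s2.1 t2.1).
  by apply: eq_bigr => i _; apply: J1E; exact: X_two_phi.
Qed.
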